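(* Let $\nu$ be a symmetric L\'evy measure on $\mathbb{R}^n$, let $\Omega\subseteq\mathbb{R}^n$ be nonempty, open and bounded, let $\Omega'\subseteq\Omega$ be nonempty and open, $f\in L^2(\Omega)$, $u\in V_\nu^{\Omega}(\mathbb{R}^n)$, and suppose $\langle u,\phi\rangle_\nu=\int_\Omega f\phi\,dx$ for every $\phi\in H_\nu^{\Omega}(\mathbb{R}^n)$. Then $\langle u,\psi\rangle_\nu=\int_{\Omega'}f\psi\,dx$ for every $\psi\in H_\nu^{\Omega'}(\mathbb{R}^n)$.
   Context: All functions are real-valued. A symmetric L\'evy measure is a nonnegative Borel measure $\nu$ on $\mathbb{R}^n$ with $\nu(\{0\})=0$, $\nu(-A)=\nu(A)$ for every Borel $A$, and $\int_{\mathbb{R}^n}(1\wedge|y|^2)\,d\nu(y)<\infty$. For $x\in\mathbb{R}^n$, $\nu_x(A)=\nu(A-x)$. For nonempty open $D\subseteq\mathbb{R}^n$, $V_\nu^D(\mathbb{R}^n)$ is the space of Borel measurable $u$ on $\mathbb{R}^n$ (identified if equal a.e.) with $\|u\|_{L^2(D)}^2+\frac12\int_D\int_{\mathbb{R}^n}(u(x)-u(y))^2\,d\nu_y(x)\,dy<\infty$, and $H_\nu^D(\mathbb{R}^n)=\{u\in V_\nu^D(\mathbb{R}^n):u=0\text{ a.e. in }\mathbb{R}^n\setminus D\}$. For $u\in V_\nu^D(\mathbb{R}^n)$ and $\phi\in H_\nu^D(\mathbb{R}^n)$, $$\langle u,\phi\rangle_\nu=\frac12\int_{\mathbb{R}^n}\int_{\mathbb{R}^n}(u(x)-u(y))(\phi(x)-\phi(y))\,d\nu_y(x)\,dy.$$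 *)

(* Defs.v *)
From HB Require Import structures.
From mathcomp Require Import all_boot all_order all_algebra.
From mathcomp Require Import all_classical all_reals all_analysis.
From mathcomp Require Import measurable_realfun.

Set Implicit Arguments.
Unset Strict Implicit.
Unset Printing Implicit Defensive.

Import Order.TTheory GRing.Theory Num.Theory.
Import numFieldNormedType.Exports.

Local Open Scope classical_set_scope.
Local Open Scope ring_scope.

(* R^n is 'rV[R]_n with its Borel sigma-algebra. *)
HB.instance Definition _ (R : realType) (n : nat) :=
  @isMeasurable.Build (sigma_display (@open 'rV[R]_n)) 'rV[R]_n
    <<s @open 'rV[R]_n >> (@sigma_algebra0 _ setT (@open 'rV[R]_n))
    (@sigma_algebraC 'rV[R]_n (@open 'rV[R]_n))
    (@sigma_algebra_bigcup _ setT (@open 'rV[R]_n)).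

Section lebesgue_rV.
Context {R : realType}.

Lemma measurable_fun_rV d (T : measurableType d) n (f : T -> 'rV[R]_n) :
  (forall i, measurable_fun [set: T] (fun x => f x ord0 i)) ->
  measurable_fun [set: T] f.
Proof.
move=> mf; apply: (@measurability _ _ T 'rV[R]_n setT f (@open 'rV[R]_n)) => //.
move=> _ [U oU <-]; rewrite setTI.
pose W (p : 'rV[rat]_n * nat) : set T :=
  \bigcap_(i in [set: 'I_n])
    ((fun x => f x ord0 i) @^-1` ball (ratr (p.1 ord0 i) : R) p.2.+1%:R^-1).
pose V (p : 'rV[rat]_n * nat) : set T :=
  if `[< ball (map_mx ratr p.1 : 'rV[R]_n) p.2.+1%:R^-1 `<=` U >]
  then W p else set0.
have -> : f @^-1` U = \bigcup_p V p.
  apply/seteqP; split => [x Ux|x [p _]]; last first.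
    rewrite /V; case: ifPn => [/asboolP pU Wx|//]; apply: pU.
    have p0 : (0 : R) < p.2.+1%:R^-1 by rewrite invr_gt0.
    by split => // i j; rewrite mxE ord1; exact: Wx.
  have /nbhs_ballP[e /= e0 eU] : nbhs (f x) U by exact: open_nbhs_nbhs.
  have [k ke] : exists k : nat, k.+1%:R^-1 < e / 2.
    have e20 : 0 < e / 2 by rewrite divr_gt0.
    have [k _ /(_ k (leqnn k)) ke] := @near_infty_natSinv_lt R (PosNum e20).
    by exists k.
  have k0 : (0 : R) < k.+1%:R^-1 by rewrite invr_gt0.
  have hq i : exists q : rat, ball (f x ord0 i) k.+1%:R^-1 (ratr q : R).
    have [||r [br [q _ qr]]] :=
      @dense_rat R (ball (f x ord0 i) k.+1%:R^-1); last by exists q; rewrite qr.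
    - by exists (f x ord0 i); exact: ballxx.
    - exact: ball_open.
  have [q hqq] := choice hq.
  exists (\row_i q i, k) => //; rewrite /V; case: ifPn => [_ i _|/asboolP[]].
    by rewrite /= mxE; exact: ball_sym.
  move=> y [_ yb]; apply: eU; split => // i j.
  have := yb i j; rewrite ord1 !mxE => {}yb.
  apply: (@le_ball _ _ _ (k.+1%:R^-1 + k.+1%:R^-1)).
    by rewrite [leRHS]splitr lerD// ltW.
  by apply: ball_triangle yb; exact: hqq.
apply: countable_bigcupT_measurable => // p; rewrite /V; case: ifPn => // _.
apply: fin_bigcap_measurable; first exact: finite_finset.
move=> i _; rewrite -[X in measurable X]setTI; apply: mf => //.
by apply: open_measurable; exact: ball_open.
Qed.

Lemma measurable_coord_rV n (i : 'I_n) :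
  measurable_fun [set: 'rV[R]_n] (fun x => x ord0 i).
Proof.
have h : measurable_fun [set: 'rV[R]_n]
    ((fun x => x ord0 i) : 'rV[R]_n -> measurableTypeR R).
  apply: (measurability _ (RGenOpens.measurableE R)) => //.
  move=> _ [_ [a [b ->]] <-]; rewrite setTI; apply: sub_sigma_algebra.
  by apply: (@open_comp _ _ (fun x : 'rV[R]_n => x ord0 i)) => [x _|];
    [exact: coord_continuous|exact: interval_open].
exact: h.
Qed.

Definition cons_rV n (p : measurableTypeR R * 'rV[R]_n) : 'rV[R]_n.+1 :=
  \row_i oapp (p.2 ord0) p.1 (unlift ord0 i).

Definition uncons_rV n (x : 'rV[R]_n.+1) : measurableTypeR R * 'rV[R]_n :=
  (x ord0 ord0, \row_i x ord0 (lift ord0 i)).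

Lemma cons_rVK n : cancel (@cons_rV n) (@uncons_rV n).
Proof.
move=> [a x]; rewrite /uncons_rV mxE unlift_none; congr pair.
by apply/rowP => i; rewrite !mxE liftK.
Qed.

Lemma measurable_cons_rV n : measurable_fun setT (@cons_rV n).
Proof.
apply: measurable_fun_rV => i; case: (unliftP ord0 i) => [j|] ->.
  apply: (eq_measurable_fun ((fun x : 'rV[R]_n => x ord0 j) \o snd)) => [p _|].
    by rewrite mxE liftK.
  exact: measurableT_comp (measurable_coord_rV j) _.
by apply: (eq_measurable_fun fst) => // p _; rewrite mxE unlift_none.
Qed.

Lemma measurable_uncons_rV n : measurable_fun setT (@uncons_rV n).
Proof.
apply: measurable_fun_pair; first exact: measurable_coord_rV.
apply: measurable_fun_rV => i.
apply: (eq_measurable_fun (fun x : 'rV[R]_n.+1 => x ord0 (lift ord0 i))).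
  by move=> x _; rewrite mxE.
exact: measurable_coord_rV.
Qed.

Section cons_measure.
Variables (n : nat) (m : {sigma_finite_measure set 'rV[R]_n -> \bar R}).

Definition cons_measure : set 'rV[R]_n.+1 -> \bar R :=
  pushforward (lebesgue_measure \x m)%E (@cons_rV n).

HB.instance Definition _ := Measure.copy cons_measure
  (measure_function_pushforward__canonical__measure_function_Measure
    (lebesgue_measure \x m)%E (@measurable_cons_rV n)).

Let cons_measure_sigma_finite : sigma_finite setT cons_measure.
Proof.
have [F FT Foo] : sigma_finite setT (lebesgue_measure \x m)%E.
  (* the canonical structure of _ \x _ found by sigma_finiteT is the one for
     probabilities *)
  have [+] := lebesgue_integral_fubini.measure_function_Measure_isSigmaFinite__to__measure_function_isSigmaFinite
    lebesgue_measure m.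
  exact.
exists (fun i => @uncons_rV n @^-1` F i) => [|i].
  by rewrite -preimage_bigcup -FT preimage_setT.
have [mF Fi] := Foo i; split.
  by rewrite -[X in measurable X]setTI; exact: measurable_uncons_rV.
rewrite /cons_measure /pushforward -comp_preimage.
by rewrite (_ : _ \o _ = id) ?preimage_id//; apply/funext => p; exact: cons_rVK.
Qed.

HB.instance Definition _ := Measure_isSigmaFinite.Build _ _ _ cons_measure
  cons_measure_sigma_finite.

End cons_measure.

(* Lebesgue measure on R^n, as the n-fold product of lebesgue_measure. *)
Fixpoint lebesgue_rV n : {sigma_finite_measure set 'rV[R]_n -> \bar R} :=
  match n with
  | 0 => \d_(0 : 'rV[R]_0)
  | n'.+1 => cons_measure (lebesgue_rV n')
  end.

Lemma lebesgue_rV_box n (A : 'I_n -> set (measurableTypeR R)) :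
  (forall i, measurable (A i)) ->
  lebesgue_rV n [set x | forall i, A i (x ord0 i)] =
  (\prod_(i < n) lebesgue_measure (A i))%E.
Proof.
elim: n A => [|n ih] A mA.
  rewrite big_ord0 /= diracE mem_set//.
  by case.
rewrite big_ord_recl -ih; last by move=> i; exact: mA.
have mB : measurable [set x : 'rV[R]_n | forall i, A (lift ord0 i) (x ord0 i)].
  rewrite (_ : [set _ | _] = \bigcap_(i in [set: 'I_n])
      ((fun x : 'rV[R]_n => x ord0 i) @^-1` A (lift ord0 i))); last first.
    by apply/seteqP; split => [x h i _|x h i]; have := h i; exact.
  apply: fin_bigcap_measurable; first exact: finite_finset.
  move=> i _; rewrite -[X in measurable X]setTI.
  by apply: (measurable_coord_rV i) => //; exact: mA.
rewrite /= /cons_measure /pushforward -product_measure1E//.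
congr ((_ \x _)%E _); apply/seteqP; split => -[a x] /=.
  move=> h; split; first by have := h ord0; rewrite mxE unlift_none.
  by move=> i; have := h (lift ord0 i); rewrite mxE liftK.
move=> [Aa Ax] i; rewrite mxE.
by case: (unliftP ord0 i) => [j|] -> //=; exact: Ax.
Qed.

End lebesgue_rV.

Section levy.
Context {R : realType} {n : nat}.
Implicit Types (nu : {measure set 'rV[R]_n -> \bar R}) (D : set 'rV[R]_n).
Implicit Types (u phi : 'rV[R]_n -> R).

(* The Euclidean norm: `|x| is the sup norm on 'rV[R]_n. *)
Definition enorm (x : 'rV[R]_n) : R := Num.sqrt (\sum_i x ord0 i ^+ 2).

Definition symmetric_levy nu : Prop :=
  [/\ nu [set 0] = 0%E,
      forall A : set 'rV[R]_n, measurable A -> nu [set - y | y in A] = nu A &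
      (\int[nu]_y (Num.min 1 (enorm y ^+ 2))%:E < +oo)%E].

(* nu_x(A) = nu (A - x), see levy_atE. *)
Definition levy_at nu (x : 'rV[R]_n) : set 'rV[R]_n -> \bar R :=
  pushforward nu (fun h => h + x).

Lemma levy_atE nu (x : 'rV[R]_n) (A : set 'rV[R]_n) :
  levy_at nu x A = nu [set a - x | a in A].
Proof.
rewrite /levy_at /pushforward; congr (nu _); apply/seteqP; split => [h Ah|].
  by exists (h + x) => //; rewrite addrK.
by move=> _ [a Aa <-]; rewrite /= subrK.
Qed.

Lemma measurable_addr_rV (x : 'rV[R]_n) : measurable_fun setT (fun h : 'rV[R]_n => h + x).
Proof.
apply: measurable_fun_rV => i.
apply: (eq_measurable_fun (fun h : 'rV[R]_n => h ord0 i + x ord0 i)).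
  by move=> h _; rewrite mxE.
by apply: measurable_funD => //; exact: measurable_coord_rV.
Qed.

HB.instance Definition _ nu x := Measure.copy (levy_at nu x)
  (measure_function_pushforward__canonical__measure_function_Measure
    nu (measurable_addr_rV x)).

Definition sqr_norm_V nu D u : \bar R :=
  (\int[lebesgue_rV n]_(x in D) (u x ^+ 2)%:E
   + 2^-1%:E * \int[lebesgue_rV n]_(y in D)
                 \int[levy_at nu y]_x ((u x - u y) ^+ 2)%:E)%E.

(* The elements of V_nu^D(R^n) and H_nu^D(R^n) are represented by Borel
   functions, not by classes modulo a.e. equality. *)
Definition V_space nu D : set ('rV[R]_n -> R) :=
  [set u | measurable_fun setT u /\ (sqr_norm_V nu D u < +oo)%E].

Definition H_space nu D : set ('rV[R]_n -> R) :=
  [set u | V_space nu D u /\ {ae lebesgue_rV n, forall x, ~ D x -> u x = 0}].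

(* Extended-real valued, but finite when u is in V_space nu D and phi is in
   H_space nu D. *)
Definition levy_form nu u phi : \bar R :=
  (2^-1%:E * \int[lebesgue_rV n]_y
     \int[levy_at nu y]_x ((u x - u y) * (phi x - phi y))%:E)%E.

Definition square_integrable_on D (f : 'rV[R]_n -> R) : Prop :=
  measurable_fun D f /\ (\int[lebesgue_rV n]_(x in D) (f x ^+ 2)%:E < +oo)%E.

End levy.

(* Main.v *)
From HB Require Import structures.
Require Import Defs.
From mathcomp Require Import all_boot all_order all_algebra.
From mathcomp Require Import all_classical all_reals all_analysis.
From mathcomp Require Import measurable_realfun.

Import Order.TTheory GRing.Theory Num.Theory.
Import numFieldNormedType.Exports.

Local Open Scope classical_set_scope.
Local Open Scope ring_scope.

(** A solution on Omega is a solution on a smaller Omega' because every test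
    function psi for Omega' is also a test function for Omega: the two form
    values are then literally the same, and the right-hand side integral over
    Omega reduces to the one over Omega' since psi vanishes a.e. off Omega'.

    Only the finiteness of the energy of psi requires an argument
    ([subset_H_space]): membership in H^Omega' controls the increments of psi
    based at points of Omega', while H^Omega involves those based at points of
    the larger set Omega.  In fact the increments based anywhere are controlled
    ([energy_le]).  Write an increment as psi (y + h) - psi y, with h distributed
    according to nu.  For fixed h and almost every y it vanishes unless y or
    y + h lies in Omega', so the total energy is at most the energy over y in
    Omega' plus the energy over y + h in Omega'.  The two are equal: reverse
    the jump, i.e. take y + h as the new base point and - h as the new jump;
    this preserves the product of Lebesgue measure and nu because the former is
    invariant under translations and the latter under h |-> - h.

    Integrating first in y for fixed h is an application of Tonelli's theorem,
    which requires nu to be sigma-finite ([symmetric_levy_sigma_finite]);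
    this holds since 1 /\ |y|^2 is nu-integrable and vanishes only at 0,
    a nu-null point. *)

(** * Translation invariance of Lebesgue measure *)

Lemma lebesgue_measure_shift (R : realType) (a : R) (A : set R) :
  measurable A ->
  pushforward lebesgue_measure ((fun t => t + a) : _ -> measurableTypeR R) A =
  lebesgue_measure A.
Proof.
move=> mA.
have ms : measurable_fun [set: measurableTypeR R]
    ((fun t => t + a) : _ -> measurableTypeR R) by exact: measurable_funD.
pose m := measure_function_pushforward__canonical__measure_function_Measure
  (@lebesgue_measure R) ms.
apply/esym; apply: (lebesgue_measure_unique (mu := m)) => //= _ [[x y]] _ <-.
rewrite /pushforward.
have -> : (fun t : R => t + a) @^-1` `]x, y]%classic = `]x - a, y - a]%classic.
  by apply/seteqP; split => t /=; rewrite !in_itv/= lerBrDr ltrBlDr.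
by rewrite !lebesgue_measure_itv/= !lte_fin ltrBlDr subrK -!EFinB opprB addrA subrK.
Qed.

(** By induction on the dimension: the translate of the product measure agrees
    with the product measure on rectangles, hence everywhere. *)
Lemma lebesgue_rV_shift (R : realType) (n : nat) (a : 'rV[R]_n)
    (A : set 'rV[R]_n) : measurable A ->
  pushforward (lebesgue_rV n) (fun x => x + a) A = lebesgue_rV n A.
Proof.
elim: n a A => [|n ih] a A mA.
  rewrite /pushforward; congr (lebesgue_rV 0 _).
  by apply/seteqP; split => x /=; rewrite [x + a](thinmx0 _) [x](thinmx0 _).
(* the translation by a, read on R * R^n through cons_rV *)
pose s (p : measurableTypeR R * 'rV[R]_n) : measurableTypeR R * 'rV[R]_n :=
  (p.1 + a ord0 ord0, p.2 + \row_i a ord0 (lift ord0 i)).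
have ms : measurable_fun setT s.
  apply: measurable_fun_pair; first exact: measurable_funD.
  exact: (measurableT_comp (measurable_addr_rV _)).
have mpre d (T : measurableType d) d' (T' : measurableType d') (g : T -> T') (B : set T') :
    measurable_fun setT g -> measurable B -> measurable (g @^-1` B).
  by move=> mg mB; rewrite -[X in measurable X]setTI; exact: mg.
have mcA := mpre _ _ _ _ _ _ (@measurable_cons_rV R n) mA.
pose m := measure_function_pushforward__canonical__measure_function_Measure
  (lebesgue_measure \x lebesgue_rV n)%E ms.
rewrite /= /cons_measure {1 2}/pushforward.
have sE p : cons_rV p + a = cons_rV (s p).
  apply/rowP => i; rewrite !mxE.
  by case: (unliftP ord0 i) => [j|] -> /=; rewrite ?mxE.
have -> : @cons_rV R n @^-1` ((fun x => x + a) @^-1` A) =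
          s @^-1` (@cons_rV R n @^-1` A).
  by apply/seteqP; split => p; rewrite /preimage/= sE.
rewrite /pushforward.
have mE := @product_measure_unique _ _ _ _ R lebesgue_measure (lebesgue_rV n) m.
symmetry; apply: mE => // B C mB mC.
rewrite /= /pushforward.
have -> : s @^-1` (B `*` C) =
    ((fun t => t + a ord0 ord0) @^-1` B) `*`
    ((fun x => x + \row_i a ord0 (lift ord0 i)) @^-1` C).
  by apply/seteqP; split => -[t x].
rewrite product_measure1E.
- by congr (_ * _)%E; [exact: (@lebesgue_measure_shift R)|exact: ih].
- by apply: mpre => //; exact: measurable_funD.
- by apply: mpre => //; exact: measurable_addr_rV.
Qed.

Lemma ge0_integral_measure_preserving d (T : measurableType d) (R : realType)
    (mu : {measure set T -> \bar R}) (phi : T -> T) (f : T -> \bar R) :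
  measurable_fun setT phi ->
  (forall A, measurable A -> pushforward mu phi A = mu A) ->
  measurable_fun setT f -> (forall x, 0 <= f x)%E ->
  (\int[mu]_x f (phi x) = \int[mu]_x f x)%E.
Proof.
move=> mphi mu_phi mf f0.
pose m := measure_function_pushforward__canonical__measure_function_Measure
  mu mphi.
rewrite -[LHS]/(\int[mu]_(x in phi @^-1` setT) (f \o phi) x)%E.
rewrite -(ge0_integral_pushforward mphi)//.
by apply: (eq_measure_integral mu (m1 := m)) => A mA _; exact: mu_phi.
Qed.

Lemma ae_lebesgue_rV_shift (R : realType) (n : nat) (a : 'rV[R]_n)
    (P : 'rV[R]_n -> Prop) :
  {ae lebesgue_rV n, forall x, P x} ->
  {ae lebesgue_rV n, forall x, P (x + a)}.
Proof.
move=> [N [mN N0 PN]]; exists ((fun x => x + a) @^-1` N); split.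
- by rewrite -[X in measurable X]setTI; exact: measurable_addr_rV.
- exact: etrans (lebesgue_rV_shift _ _ _ _ mN) N0.
- by move=> x /= Px; exact: PN.
Qed.

(** * Measurability on R^n *)

Lemma measurable_fun_addrV d (T : measurableType d) (R : realType) (n : nat)
    (f g : T -> 'rV[R]_n) :
  measurable_fun setT f -> measurable_fun setT g ->
  measurable_fun setT (fun x => f x + g x).
Proof.
move=> mf mg; apply: measurable_fun_rV => i.
apply: (eq_measurable_fun (fun x => f x ord0 i + g x ord0 i)).
  by move=> x _; rewrite mxE.
by apply: measurable_funD; exact: (measurableT_comp (measurable_coord_rV i)).
Qed.

Lemma measurable_fun_opprV (R : realType) (n : nat) :
  measurable_fun setT (fun x : 'rV[R]_n => - x).
Proof.
apply: measurable_fun_rV => i.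
apply: (eq_measurable_fun (fun x : 'rV[R]_n => - x ord0 i)).
  by move=> x _; rewrite mxE.
exact: measurableT_comp (measurable_coord_rV i).
Qed.

Lemma enorm_gt0 (R : realType) (n : nat) (x : 'rV[R]_n) :
  x != 0 -> 0 < enorm x.
Proof.
move=> x0; rewrite sqrtr_gt0 lt_def sumr_ge0 ?andbT => [|i _]; last first.
  exact: sqr_ge0.
apply: contra x0; rewrite psumr_eq0 => [|i _]; last exact: sqr_ge0.
move=> /allP x0; apply/eqP/rowP => i; rewrite mxE; apply/eqP.
by have := x0 i (mem_index_enum _); rewrite sqrf_eq0.
Qed.

Lemma measurable_enorm (R : realType) (n : nat) :
  measurable_fun setT (@enorm R n).
Proof.
apply: (measurableT_comp (continuous_measurable_fun (@sqrt_continuous R))).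
apply: measurable_sum => i.
exact: measurable_funX (measurable_coord_rV i).
Qed.

(** * Sigma-finiteness of symmetric Levy measures *)

(** The space is covered by the null set {0} and the superlevel sets
    {1 /\ |y|^2 >= 1/(k+1)}, whose measure is finite by Markov's inequality. *)
Lemma symmetric_levy_sigma_finite (R : realType) (n : nat)
    (nu : {measure set 'rV[R]_n -> \bar R}) :
  symmetric_levy nu -> sigma_finite setT nu.
Proof.
move=> [nu0 _ nuoo].
pose g (y : 'rV[R]_n) : \bar R := (Num.min 1 (enorm y ^+ 2))%:E.
have mg : measurable_fun setT g.
  apply/measurable_EFinP; apply: measurable_minr => //.
  exact: measurable_funX (@measurable_enorm R n).
have g0 y : (0 <= g y)%E by rewrite lee_fin le_min ler01 sqr_ge0.
pose F k : set 'rV[R]_n := [set y | (k.+1%:R^-1)%:E <= g y]%E.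
have mF k : measurable (F k).
  by rewrite -[F k]setTI; exact: emeasurable_fun_c_infty.
have mset0 : measurable [set (0 : 'rV[R]_n)].
  have -> : [set (0 : 'rV[R]_n)] =
      \bigcap_(i in [set: 'I_n]) ((fun x : 'rV[R]_n => x ord0 i) @^-1` [set 0]).
    apply/seteqP; split => [_ -> i _ /=|x /= x0]; first by rewrite mxE.
    by apply/rowP => i; rewrite x0// mxE.
  apply: fin_bigcap_measurable; first exact: finite_finset.
  by move=> i _; rewrite -[X in measurable X]setTI; exact: measurable_coord_rV.
exists (fun k => [set 0] `|` F k) => [|k].
  apply/seteqP; split => // y _.
  have [->|y0] := eqVneq y 0; first by exists 0%N => //; left.
  have gy : 0 < Num.min 1 (enorm y ^+ 2).
    by rewrite lt_min ltr01 exprn_gt0// enorm_gt0.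
  have [k _ /(_ k (leqnn k)) /= ky] := @near_infty_natSinv_lt R (PosNum gy).
  by exists k => //; right; rewrite /F/= lee_fin ltW.
split; first exact: measurableU.
apply: (@le_lt_trans _ _ (nu [set 0%R] + nu (F k))%E); first exact: measureU2.
rewrite lte_add_pinfty// ?nu0//.
have k0 : 0 < (k.+1%:R^-1 : R) by rewrite invr_gt0.
have h : ((k.+1%:R^-1)%:E * nu (F k) < +oo)%E.
  apply: le_lt_trans nuoo.
  have := le_integral_abse nu measurableT mg k0.
  rewrite setTI (eq_integral g) => [|y _]; last by rewrite gee0_abs.
  by congr (_ * nu _ <= _)%E; apply: eq_set => y; rewrite gee0_abs.
rewrite ltey; apply: contraTN h => /eqP ->.
by rewrite gt0_muley ?lte_fin.
Qed.

(** * Energy of a function supported in D *)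

Section increments.
Local Open Scope ereal_scope.
Context {R : realType} {n : nat}.
Variable nu : {sigma_finite_measure set 'rV[R]_n -> \bar R}.
Hypothesis nuN : forall A : set 'rV[R]_n,
  measurable A -> nu [set (- y)%R | y in A] = nu A.

Lemma ge0_integral_levy_at y (f : 'rV[R]_n -> \bar R) :
  measurable_fun setT f -> (forall x, 0 <= f x) ->
  \int[levy_at nu y]_x f x = \int[nu]_h f (h + y)%R.
Proof.
by move=> mf f0; rewrite ge0_integral_pushforward//; exact: measurable_addr_rV.
Qed.

Lemma ge0_integral_levy_opp (f : 'rV[R]_n -> \bar R) :
  measurable_fun setT f -> (forall x, 0 <= f x) ->
  \int[nu]_h f (- h)%R = \int[nu]_h f h.
Proof.
move=> mf f0; apply: (ge0_integral_measure_preserving _ _ _ nu (fun h => - h)%R f) => //.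
  exact: measurable_fun_opprV.
move=> A mA; rewrite -[RHS]nuN// /pushforward; congr (nu _).
apply/seteqP; split => [h Ah|_ [a Aa <-]]; last by rewrite /= opprK.
by exists (- h)%R => //; rewrite opprK.
Qed.

(** The increment from y is indexed by the jump h rather than by the endpoint
    h + y, so that the inner measure nu no longer depends on y and Tonelli's
    theorem applies. *)
Definition sqr_increment (psi : 'rV[R]_n -> R) (p : 'rV[R]_n * 'rV[R]_n) :
  \bar R := ((psi (p.2 + p.1) - psi p.1) ^+ 2)%:E.

Lemma sqr_increment_ge0 psi p : 0 <= sqr_increment psi p.
Proof. by rewrite lee_fin sqr_ge0. Qed.

Lemma measurable_sqr_increment psi :
  measurable_fun setT psi -> measurable_fun setT (sqr_increment psi).
Proof.
move=> mpsi; apply/measurable_EFinP/measurable_funX/measurable_funB.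
  by apply: (measurableT_comp mpsi); exact: measurable_fun_addrV.
exact: measurableT_comp.
Qed.

Lemma integral_levy_at_sqr (psi : 'rV[R]_n -> R) y : measurable_fun setT psi ->
  \int[levy_at nu y]_x ((psi x - psi y) ^+ 2)%:E =
  \int[nu]_h sqr_increment psi (y, h).
Proof.
move=> mpsi.
rewrite (ge0_integral_levy_at y (fun x => ((psi x - psi y) ^+ 2)%:E))//.
  exact/measurable_EFinP/measurable_funX/measurable_funB.
by move=> x; rewrite lee_fin sqr_ge0.
Qed.

(** The energy over all base points is at most twice the energy over base
    points in D: almost every pair with a nonzero increment has an endpoint in
    D, and reversing the jump exchanges the two endpoints. *)
Lemma energy_le (D E : set 'rV[R]_n) (psi : 'rV[R]_n -> R) :
  measurable D -> measurable E -> measurable_fun setT psi ->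
  {ae lebesgue_rV n, forall x, ~ D x -> psi x = 0%R} ->
  \int[lebesgue_rV n]_(y in E) \int[levy_at nu y]_x ((psi x - psi y) ^+ 2)%:E <=
  \int[lebesgue_rV n]_(y in D) \int[levy_at nu y]_x ((psi x - psi y) ^+ 2)%:E +
  \int[lebesgue_rV n]_(y in D) \int[levy_at nu y]_x ((psi x - psi y) ^+ 2)%:E.
Proof.
move=> mD mE mpsi psi0; set L := lebesgue_rV n.
(* WD keeps the increments that start in D; TWD below, those that end in D *)
pose W := sqr_increment psi; pose WD p := (\1_D p.1)%:E * W p.
have mW : measurable_fun setT W := measurable_sqr_increment psi mpsi.
have W0 p : 0 <= W p := sqr_increment_ge0 psi p.
have WD0 p : 0 <= WD p by apply: mule_ge0 (W0 p); rewrite lee_fin.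
have mWD : measurable_fun setT WD.
  apply: emeasurable_funM mW; apply/measurable_EFinP.
  exact: (measurableT_comp (measurable_indic mD)).
have lW y := integral_levy_at_sqr psi y mpsi.
under eq_integral do rewrite lW.
rewrite [X in _ <= X + X](_ : _ = \int[L]_y \int[nu]_h WD (y, h)); last first.
  rewrite integral_mkcond; apply: eq_integral => y _.
  rewrite patchE; case: ifPn => yD.
    by rewrite lW; apply: eq_integral => h _; rewrite /WD indicE yD mul1e.
  by rewrite integral0_eq// => h _; rewrite /WD indicE (negbTE yD) mul0e.
apply: (@le_trans _ _ (\int[L]_y \int[nu]_h W (y, h))).
  apply: ge0_subset_integral => //.
    exact: (measurable_fun_fubini_tonelli_F (m2 := nu) W).
  by move=> y _; exact: integral_ge0.
pose TWD (p : 'rV[R]_n * 'rV[R]_n) := WD (p.2 + p.1, - p.2)%R.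
have TWD0 p : 0 <= TWD p by exact: WD0.
have mTWD : measurable_fun setT TWD.
  apply: (measurableT_comp mWD); apply: measurable_fun_pair.
    exact: measurable_fun_addrV.
  by apply: measurableT_comp => //; exact: measurable_fun_opprV.
have mG (V : 'rV[R]_n * 'rV[R]_n -> \bar R) : measurable_fun setT V ->
    (forall p, 0 <= V p) -> measurable_fun setT (fun h => \int[L]_y V (y, h)).
  exact: measurable_fun_fubini_tonelli_G.
have G0 (V : 'rV[R]_n * 'rV[R]_n -> \bar R) :
    (forall p, 0 <= V p) -> forall h, 0 <= \int[L]_y V (y, h).
  by move=> V0 h; apply: integral_ge0 => y _; exact: V0.
have tonelli := @fubini_tonelli _ _ _ _ R L nu.
rewrite (tonelli _ mW W0) (tonelli _ mWD WD0) /fubini_G.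
(* substitute h := - h, then y := y + h *)
have reflect : \int[nu]_h \int[L]_y WD (y, h) = \int[nu]_h \int[L]_y TWD (y, h).
  rewrite -(ge0_integral_levy_opp _ (mG _ mWD WD0) (G0 _ WD0)).
  apply: eq_integral => h _; symmetry.
  under eq_integral do rewrite /TWD/= addrC.
  apply: (ge0_integral_measure_preserving _ _ _ L (fun y => y + h)%R
                                          (fun y => WD (y, - h)%R)) => //.
  - exact: measurable_addr_rV.
  - exact: lebesgue_rV_shift.
  - exact: measurable_fun_pair1.
rewrite [X in _ <= X + _]reflect.
rewrite -(ge0_integralD _ measurableT (fun h _ => G0 _ TWD0 h) (mG _ mTWD TWD0)
                        (fun h _ => G0 _ WD0 h) (mG _ mWD WD0)).
apply: ge0_le_integral.
- exact: measurableT.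
- by move=> h _; exact: G0.
- exact: mG.
- exact: emeasurable_funD (mG _ mTWD TWD0) (mG _ mWD WD0).
- move=> h _.
have m1 (V : 'rV[R]_n * 'rV[R]_n -> \bar R) : measurable_fun setT V ->
    measurable_fun setT (fun y => V (y, h)).
  exact: measurable_fun_pair1.
rewrite -(ge0_integralD _ measurableT (fun y _ => TWD0 (y, h)) (m1 _ mTWD)
                        (fun y _ => WD0 (y, h)) (m1 _ mWD)).
apply: ae_ge0_le_integral.
- exact: measurableT.
- by move=> y _; exact: W0.
- exact: m1.
- by move=> y _; exact: adde_ge0.
- exact: emeasurable_funD (m1 _ mTWD) (m1 _ mWD).
(* if neither y nor y + h lies in D, then psi y = psi (y + h) = 0 for a.e. y *)
have psih := ae_lebesgue_rV_shift R n h _ psi0.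
apply: filterS2 psi0 psih => y py pyh _.
have TWDE : TWD (y, h) = (\1_D (y + h)%R)%:E * W (y, h).
  rewrite /TWD /WD /W /sqr_increment/= addrA addNr add0r.
  by rewrite -[in LHS]opprB sqrrN [(h + y)%R]addrC.
rewrite TWDE /WD/= !indicE.
have [yD|yD] := boolP (y \in D).
  by rewrite mul1e; apply: leeDr; apply: mule_ge0 (W0 _); rewrite lee_fin.
have [yhD|yhD] := boolP ((y + h)%R \in D); first by rewrite mul0e mul1e adde0.
rewrite !mul0e adde0 /W /sqr_increment/= [(h + y)%R]addrC.
rewrite py; last by move=> /mem_set; exact/negP.
rewrite pyh; last by move=> /mem_set; exact/negP.
by rewrite subrr expr0n.
Qed.

End increments.

(** * Extension of the domain *)

Lemma integral_ae_support d (T : measurableType d) (R : realType)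
    (mu : {measure set T -> \bar R}) (D E : set T) (g : T -> \bar R) :
  measurable D -> measurable E -> D `<=` E -> measurable_fun E g ->
  {ae mu, forall x, ~ D x -> g x = 0%E} ->
  (\int[mu]_(x in E) g x = \int[mu]_(x in D) g x)%E.
Proof.
move=> mD mE DE mg g0.
rewrite -[in RHS](setIidr DE) integral_mkcondr.
apply: ae_eq_integral => //.
  apply/(measurable_restrict _ mD mE).
  by apply: measurable_funS mg => // x [].
apply: filterS g0 => x g0 _; rewrite patchE; case: ifPn => // xD.
by apply: g0 => /mem_set; exact/negP.
Qed.

Section levy_sigma_finite.
Context {R : realType} {n : nat} {nu : {measure set 'rV[R]_n -> \bar R}}.

(** A copy of nu that depends on hnu, so that the canonical sigma-finite
    structure can be built from that proof. *)
Definition levy_sigma_finite (hnu : symmetric_levy nu) :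
  set 'rV[R]_n -> \bar R := nu.

HB.instance Definition _ hnu := Measure.copy (levy_sigma_finite hnu) nu.

HB.instance Definition _ hnu := Measure_isSigmaFinite.Build _ _ _
  (levy_sigma_finite hnu) (symmetric_levy_sigma_finite R n nu hnu).

End levy_sigma_finite.

(** The L^2 norm over E is the one over D because psi vanishes a.e. off D, and
    the energy over E is at most twice the one over D by [energy_le]. *)
Lemma subset_H_space (R : realType) (n : nat)
    (nu : {measure set 'rV[R]_n -> \bar R}) (D E : set 'rV[R]_n) :
  symmetric_levy nu -> measurable D -> measurable E -> D `<=` E ->
  H_space nu D `<=` H_space nu E.
Proof.
move=> hnu mD mE DE psi [[mpsi finD] psi0]; split; last first.
  by apply: filterS psi0 => x psi0 Ex; apply: psi0 => /DE.
split => //.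
have [_ nuN _] := hnu.
have le2 := @energy_le R n (levy_sigma_finite hnu) nuN D E psi mD mE mpsi psi0.
have sqr0 y : (0 <= \int[levy_at nu y]_x ((psi x - psi y) ^+ 2)%:E)%E.
  by apply: integral_ge0 => x _; rewrite lee_fin sqr_ge0.
have halfD : (0 <= 2^-1%:E * \int[lebesgue_rV n]_(y in D)
    \int[levy_at nu y]_x ((psi x - psi y) ^+ 2)%:E)%E.
  by apply: mule_ge0 => //; exact: integral_ge0.
have L2D : (0 <= \int[lebesgue_rV n]_(x in D) (psi x ^+ 2)%:E)%E.
  by apply: integral_ge0 => x _; rewrite lee_fin sqr_ge0.
rewrite /sqr_norm_V in finD *.
rewrite (@integral_ae_support _ _ _ _ D)//; last 2 first.
- exact/measurable_EFinP/measurable_funX/measurable_funTS.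
- by apply: filterS psi0 => x psi0 Dx; rewrite psi0// expr0n.
apply: lte_add_pinfty; first exact: le_lt_trans (leeDl _ halfD) finD.
have {finD} finD := le_lt_trans (leeDr _ L2D) finD.
apply: (@le_lt_trans _ _ (2^-1%:E * \int[lebesgue_rV n]_(y in D)
    \int[levy_at nu y]_x ((psi x - psi y) ^+ 2)%:E +
  2^-1%:E * \int[lebesgue_rV n]_(y in D)
    \int[levy_at nu y]_x ((psi x - psi y) ^+ 2)%:E)%E); last first.
  exact: lte_add_pinfty.
rewrite -muleDr// ?ge0_adde_def ?inE ?integral_ge0//.
by rewrite lee_pmul2l.
Qed.

Theorem proposition4p11 (R : realType) (n : nat)
    (nu : {measure set 'rV[R]_n -> \bar R}) (hnu : symmetric_levy nu)
    (Omega Omega' : set 'rV[R]_n)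
    (Omega_neq0 : Omega !=set0) (Omega_open : open Omega)
    (Omega_bounded : bounded_set Omega)
    (Omega'_sub : Omega' `<=` Omega)
    (Omega'_neq0 : Omega' !=set0) (Omega'_open : open Omega')
    (f u : 'rV[R]_n -> R)
    (hf : square_integrable_on Omega f) (hu : V_space nu Omega u)
    (hsol : forall phi, H_space nu Omega phi ->
       levy_form nu u phi =
       (\int[lebesgue_rV n]_(x in Omega) (f x * phi x)%:E)%E) :
  forall psi, H_space nu Omega' psi ->
    levy_form nu u psi =
    (\int[lebesgue_rV n]_(x in Omega') (f x * psi x)%:E)%E.

Proof.
have mO : measurable Omega by exact: sub_sigma_algebra.
have mO' : measurable Omega' by exact: sub_sigma_algebra.
move=> psi Hpsi.
rewrite (hsol psi (subset_H_space _ _ _ _ _ hnu mO' mO Omega'_sub _ Hpsi)).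
have [[mpsi _] psi0] := Hpsi.
apply: integral_ae_support => //.
  apply/measurable_EFinP/measurable_funM; first by case: hf.
  exact: measurable_funTS.
by apply: filterS psi0 => x psi0 /psi0 ->; rewrite mulr0.
Qed.
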